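(* Consider an instance of the Capacitated $p$-Location Problem with Territorial Coverage Constraints given by $\langle J,I,p,W,R\rangle$ and a partition $S=\{S_1,\ldots,S_{m^S}\}$ of $I$, with $p\ge m^S$, so that the coverage constraints are $\sum_{j\in J(S_k)}y_j\ge 1$ for all $k\in\{1,\ldots,m^S\}$. Let $K'\subset S$ be a subset of subareas with $$\sum_{S_k\in K'}|J(S_k)|>p-m^S+|K'|.$$ Then every feasible solution $(x,y)$ satisfies $$\sum_{S_k\in K'}\ \sum_{j\in J(S_k)}y_j\le p-m^S+|K'| .$$
   Context: An instance $\langle J,I,p,W,R\rangle$ of the Capacitated $p$-Location Problem (CpLP) consists of a finite set $I$ of customers, a finite set $J$ of candidate facility locations, an integer $p$, demands $W_i\ge 0$ ($i\in I$), capacities $R_j\ge 0$ ($j\in J$), together with allocation costs $cost(i,j)$. Feasible solutions are pairs $(x,y)$ with $y_j\in\{0,1\}$ and $$\sum_{j\in J}x_{ij}=1\ (i\in I),\qquad \sum_{j\in J}y_j=p,\qquad \sum_{i\in I}W_ix_{ij}\le R_jy_j\ (j\in J),$$ where either $x_{ij}\in\{0,1\}$ (capacitated $p$-median variant) or $x_{ij}\in[0,1]$ (relaxed variant); the CpLP covers both variants, and the objective is to minimize $\sum_{i,j}cost(i,j)x_{ij}$. The customers in $I$ are distinct spatial units making up a geographical area, and each location in $J$ is a point lying in exactly one of these units. For a block (subarea) $S_k$ of a partition $S=\{S_1,\ldots,S_{m^S}\}$ of $I$, $J(S_k)\subseteq J$ is the set of locations lying within $S_k$. The problem with Territorial Coverage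 Constraints (CpLP-TC) adds to the CpLP the constraints $\sum_{j\in J(S_k)}y_j\ge 1$ for all $k$ if $p\ge m^S$, and $\sum_{j\in J(S_k)}y_j\le 1$ for all $k$ if $p\le m^S$. *)

(* Defs.v *)
From HB Require Import structures.
From mathcomp Require Import all_boot all_order all_algebra.

Set Implicit Arguments.
Unset Strict Implicit.
Unset Printing Implicit Defensive.

Import Order.TTheory GRing.Theory Num.Theory.
Local Open Scope ring_scope.

(* [unit_of j] is the unique spatial unit (customer) in which the location [j]
   lies: a function, since each location is in exactly one unit. *)
Record instance (F : realFieldType) (I J : finType) := Instance {
  nfac : int;
  demand : I -> F;
  capacity : J -> F;
  cost : I -> J -> F;
  unit_of : J -> I;
  demand_ge0 : forall i, 0 <= demand i;
  capacity_ge0 : forall j, 0 <= capacity j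
}.

Inductive variant := Median | Relaxed.

Section Problem.
Variables (F : realFieldType) (I J : finType).
Implicit Types (P : instance F I J) (x : I -> J -> F) (y : J -> F).
Implicit Types (S : {set {set I}}) (B : {set I}).

Definition allocation_domain (v : variant) (a : F) : Prop :=
  match v with
  | Median => a = 0 \/ a = 1
  | Relaxed => 0 <= a <= 1
  end.

Definition cplp_feasible (v : variant) P x y : Prop :=
  [/\ (forall j, y j = 0 \/ y j = 1),
      (forall i j, allocation_domain v (x i j)),
      (forall i, \sum_j x i j = 1),
      \sum_j y j = (nfac P)%:~R
    & forall j, \sum_i demand P i * x i j <= capacity P j * y j].

Definition objective P x : F := \sum_i \sum_j cost P i j * x i j.

Definition locations P B : {set J} := [set j | unit_of P j \in B].

(* When [nfac P] equals the number of blocks both cases apply and force exactly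
   one open location per block; the first case already implies the second
   since the [y j] sum to [nfac P]. *)
Definition territorial_coverage P S y : Prop :=
  (#|S|%:Z <= nfac P ->
     forall B, B \in S -> 1 <= \sum_(j in locations P B) y j) /\
  (nfac P <= #|S|%:Z ->
     forall B, B \in S -> \sum_(j in locations P B) y j <= 1).

Definition cplp_tc_feasible (v : variant) P S x y : Prop :=
  cplp_feasible v P x y /\ territorial_coverage P S y.

End Problem.

(* Main.v *)
(* Every location lies in exactly one block, so the block sums of [y] add up to
   [p]; each of the [m^S - |K'|] blocks outside [K'] accounts for at least one
   open location. *)
Require Import Defs.
From HB Require Import structures.
From mathcomp Require Import all_boot all_order all_algebra.

Set Implicit Arguments.
Unset Strict Implicit.
Unset Printing Implicit Defensive.

Import Order.TTheory GRing.Theory Num.Theory.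
Local Open Scope ring_scope.

(** Complementary counting: by [sum_locations] the [p] open locations split over the blocks of [S],
    and coverage makes the blocks outside [K'] use at least [m^S - |K'|] of them; [K'] gets at most
    the rest. *)

Lemma sum_locations (F : realFieldType) (I J : finType) (P : instance F I J)
    (S : {set {set I}}) (y : J -> F) :
  partition S [set: I] ->
  \sum_(B in S) \sum_(j in locations P B) y j = \sum_j y j.
Proof.
move=> /and3P[/eqP coverS tiS _].
have covered j : unit_of P j \in cover S by rewrite coverS inE.
(* Locations are grouped by the block holding their unit; disjointness of blocks makes the fibre
   over [B] exactly [locations P B]. *)
rewrite [RHS](partition_big (fun j => pblock S (unit_of P j)) [in S]) /=.
  apply: eq_bigr => B SB; apply: eq_bigl => j; rewrite inE.
  by apply/idP/eqP => [/(def_pblock tiS SB) // | <-]; rewrite mem_pblock.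
by move=> j _; rewrite pblock_mem.
Qed.

Theorem mainTheorem5 (F : realFieldType) (I J : finType) (v : variant)
    (P : instance F I J) (S : {set {set I}}) (K' : {set {set I}})
    (partS : partition S [set: I])
    (le_mp : #|S|%:Z <= nfac P)
    (sK'S : K' \subset S)
    (largeK' : nfac P - #|S|%:Z + #|K'|%:Z
                 < (\sum_(B in K') #|locations P B|)%N%:Z)
    (x : I -> J -> F) (y : J -> F)
    (feas : cplp_tc_feasible v P S x y) :
  \sum_(B in K') \sum_(j in locations P B) y j
    <= (nfac P - #|S|%:Z + #|K'|%:Z)%:~R.
Proof.
have [[_ _ _ sum_y _] [/(_ le_mp) cover_ge1 _]] := feas.
rewrite !rmorphD rmorphN /= -sum_y -(sum_locations P y partS).
(* With [p] written as the total over [S], the [K'] part cancels from both sides. *)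
rewrite (big_setID (A := S) K') /= (setIidPr sK'S) -!addrA lerDl.
rewrite -(cardsID K' S) (setIidPr sK'S) PoszD rmorphD /= opprD addrAC addNr.
(* What remains bounds [#|S :\: K'|] by the sum outside [K']; as a sum of ones it compares block by
   block. *)
rewrite add0r subr_ge0 -pmulrn -sumr_const.
by apply: ler_sum => B /setDP[SB _]; apply: cover_ge1.
Qed.
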